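(* Assume that $g$ is Lipschitz-continuous with a constant $\ell_g>0$ and that the stabilization parameter satisfies $\kappa\ge2\ell_g$. Let $\tau>0$. Consider the two-stage scheme ($s=2$) $$U^{n,i+1}=U^{n,1}+\sum_{j=1}^{i}\hat a_{i+1,j}(-\tau L_\kappa)\big[\tau g_\kappa(U^{n,j})-\tau L_\kappa U^{n,1}\big],\quad 1\le i\le 2,\qquad U^{n,1}=u_h^{n-1},\ u_h^n=U^{n,3},\ n\ge1,$$ with either of the following sets of coefficients: (TIF2-Ralston) $\hat a_{21}(z)=\frac2{3-2z}$, $\ \hat a_{31}(z)=\frac{e^{2z/3}}{(4-z)e^{2z/3}-3z}$, $\ \hat a_{32}(z)=\frac{3}{(4-z)e^{2z/3}-3z}$; (NIF2-Ralston) $\hat a_{21}(z)=\frac{e^{2z/3}-1}{z}$, $\ \hat a_{31}(z)=\frac14e^z$, $\ \hat a_{32}(z)=\frac{e^z-1}{z}-\frac14e^z$. Then both the TIF2-Ralston and the NIF2-Ralston schemes preserve the original energy dissipation law at all stages (in the sense defined in the context).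
   Context: Setting: $L_h$ is a symmetric positive definite real $M\times M$ matrix (a spatial discretization of a stiff linear operator). $G$ is a non-negative differentiable (Lyapunov) function and $g(v)=-\frac{\delta}{\delta v}G(v)$, i.e. $g=-G'$; both $G$ and $g$ act componentwise on vectors in $\mathbb{R}^M$. The inner product is $\langle u,v\rangle:=v^Tu$. The original energy is $E[u]:=\frac12\langle u,L_hu\rangle+\langle G(u),1\rangle$, where $1$ is the all-ones vector; the problem $u_h'+L_hu_h=g(u_h)$ is the gradient flow $\frac{du_h}{dt}=-\frac{\delta E}{\delta u_h}$, with $\frac{dE}{dt}=-\langle\frac{du_h}{dt},\frac{du_h}{dt}\rangle\le0$. For $\kappa\ge0$ put $L_\kappa:=L_h+\kappa I$, $g_\kappa(u):=\kappa u+g(u)$, so the gradient flow is equivalently $u_h'=-L_\kappa u_h+g_\kappa(u_h)$. Functions $f(-\tau L_\kappa)$ are matrix functions of the symmetric matrix $-\tau L_\kappa$ (spectrum in $(-\infty,0)$). Differentiation matrix: for an $s$-stage scheme of the displayed form, let $\widehat A(z):=[\hat a_{i+1,j}(z)]_{i,j=1}^s$ (lower triangular, with zero entries for $j>i$), $E_s:=(1_{i\ge j})_{s\times s}$ the lower triangular all-ones matrix, $I$ the identity, and $$D(z):=\widehat A(z)^{-1}E_s+zE_s-\frac z2I .$$ $D_j(z):=D[1:j,1:j]$ is its $j$-th leading principal submatrix, and $D_j(-\tau L_\kappa)$ is the $j\times j$ block matrix obtained by replacing each scalar entry $d_{k\ell}(z)$ with the matrix $d_{k\ell}(-\tau L_\kappa)$.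 Put $\delta_\tau U^{n,\ell+1}:=U^{n,\ell+1}-U^{n,\ell}$ and $\delta_\tau\vec U_{n,j+1}:=(\delta_\tau U^{n,2},\dots,\delta_\tau U^{n,j+1})^T$. The scheme ''preserves the original energy dissipation law at all stages'' means: for all $n\ge1$ and $1\le j\le s$, $$E[U^{n,j+1}]-E[U^{n,1}]\le-\frac1\tau\big\langle\delta_\tau\vec U_{n,j+1},\,D_j(-\tau L_\kappa)\,\delta_\tau\vec U_{n,j+1}\big\rangle\le 0,$$ where the inner product of block vectors is the sum of the inner products of the blocks; in particular $E[U^{n,j+1}]\le E[U^{n,1}]$. *)

(* Defs.v *)
From HB Require Import structures.
From mathcomp Require Import all_boot all_order all_algebra.
From mathcomp Require Import all_classical all_reals all_analysis.

Set Implicit Arguments.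
Unset Strict Implicit.
Unset Printing Implicit Defensive.

Import Order.TTheory GRing.Theory Num.Theory.
Import numFieldNormedType.Exports.

Local Open Scope classical_set_scope.
Local Open Scope ring_scope.

Definition inner {R : realType} {m : nat} (u v : 'cV[R]_m) : R :=
  (v^T *m u) 0 0.

Definition spd {R : realType} {m : nat} (L : 'M[R]_m) : Prop :=
  L \is symmetricmx /\ forall v : 'cV[R]_m, v != 0 -> 0 < inner v (L *m v).

Definition orthodiag {R : realType} {m : nat} (A : 'M[R]_m) :
    set ('M[R]_m * 'rV[R]_m) :=
  [set Qd | Qd.1 *m Qd.1^T = 1%:M /\ A = Qd.1^T *m diag_mx Qd.2 *m Qd.1].

(* f(A) for a real symmetric matrix A, read off an arbitrarily chosen
   orthogonal diagonalization; by [mxfunE] the choice is irrelevant.  The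
   default value of [xget] is used only for a non-symmetric A. *)
Definition mxfun {R : realType} {m : nat} (f : R -> R) (A : 'M[R]_m) :
    'M[R]_m :=
  let Qd := xget (1%:M, 0) (orthodiag A) in
  Qd.1^T *m diag_mx (map_mx f Qd.2) *m Qd.1.

Lemma mxfunE {R : realType} {m : nat} (f : R -> R) (A Q : 'M[R]_m)
    (d : 'rV[R]_m) :
  orthodiag A (Q, d) -> mxfun f A = Q^T *m diag_mx (map_mx f d) *m Q.
Proof.
move=> AQ; rewrite /mxfun; case: (xgetP (1%:M, 0) (orthodiag A)); last first.
  by move=> /(_ (Q, d)).
move=> [P e] _ /= [/= PP AP]; case: AQ => /= QQ; rewrite {}AP => PQ.
have P'P := mulmx1C PP; have Q'Q := mulmx1C QQ.
have /matrixP WE : (Q *m P^T) *m diag_mx e = diag_mx d *m (Q *m P^T).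
  apply: (can_inj (@mulmxK _ _ _ P _)); first by case/mulmx1_unit: PP.
  rewrite -!mulmxA P'P mulmx1 [P^T *m _]mulmxA PQ !mulmxA QQ mul1mx.
  by [].
have fWE : (Q *m P^T) *m diag_mx (map_mx f e) =
           diag_mx (map_mx f d) *m (Q *m P^T).
  apply/matrixP => i j; move: (WE i j).
  rewrite !mul_mx_diag !mul_diag_mx !mxE.
  set w := \sum_(_ < _) _; have [->|w0] := eqVneq w 0.
    by rewrite !mul0r !mulr0.
  by rewrite mulrC => /(mulIf w0) ->; rewrite mulrC.
have -> : P^T = Q^T *m (Q *m P^T) by rewrite mulmxA Q'Q mul1mx.
by rewrite -[Q^T *m _ *m _]mulmxA fWE -!mulmxA P'P mulmx1.
Qed.

(* g = - G' *)
Definition nonlin {R : realType} (G : R -> R) : R -> R := fun v => - derive1 G v.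

Definition energy {R : realType} {m : nat} (L : 'M[R]_m) (G : R -> R)
    (u : 'cV[R]_m) : R :=
  2^-1 * inner u (L *m u) + inner (map_mx G u) (const_mx 1).

Definition Lstab {R : realType} {m : nat} (kappa : R) (L : 'M[R]_m) :
    'M[R]_m :=
  L + kappa%:M.

Definition gstab {R : realType} {m : nat} (kappa : R) (g : R -> R)
    (u : 'cV[R]_m) : 'cV[R]_m :=
  kappa *: u + map_mx g u.

(* The coefficients of a scheme are given as a : nat -> nat -> R -> R, with
   [a i j] standing for \hat a_{i,j} (2 <= i <= s + 1, 1 <= j <= s).  Here
   [U n i] is the stage U^{n,i} and [u n] is u_h^n; the initial value [u 0] is
   unconstrained. *)
Definition is_scheme {R : realType} {m : nat} (s : nat)
    (a : nat -> nat -> R -> R) (L : 'M[R]_m) (g : R -> R) (kappa tau : R)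
    (u : nat -> 'cV[R]_m) (U : nat -> nat -> 'cV[R]_m) : Prop :=
  forall n : nat, (1 <= n)%N ->
    [/\ U n 1%N = u n.-1,
        forall i : nat, (1 <= i <= s)%N ->
          U n i.+1 = U n 1%N +
            \sum_(1 <= j < i.+1)
              mxfun (a i.+1 j) (- tau *: Lstab kappa L) *m
                (tau *: gstab kappa g (U n j) -
                 tau *: (Lstab kappa L *m U n 1%N))
      & u n = U n s.+1].

(* Matrix indices start at 0: row i, column j holds \hat a_{i+2,j+1}. *)
Definition Ahat {R : realType} (s : nat) (a : nat -> nat -> R -> R) (z : R) :
    'M[R]_s :=
  \matrix_(i < s, j < s) (if (j <= i)%N then a i.+2 j.+1 z else 0).

Definition Eones {R : realType} (s : nat) : 'M[R]_s :=
  \matrix_(i < s, j < s) ((j <= i)%N)%:R.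

Definition Dmx {R : realType} (s : nat) (a : nat -> nat -> R -> R) (z : R) :
    'M[R]_s :=
  invmx (Ahat s a z) *m Eones s + z *: Eones s - (z / 2) *: 1%:M.

Definition Dlead {R : realType} (s j : nat) (hj : (j <= s)%N)
    (a : nat -> nat -> R -> R) (z : R) : 'M[R]_j :=
  mxsub (widen_ord hj) (widen_ord hj) (Dmx s a z).

Definition Dblock {R : realType} {m : nat} (s j : nat) (hj : (j <= s)%N)
    (a : nat -> nat -> R -> R) (A : 'M[R]_m) :
    'M[R]_(\sum_(k < j) m, \sum_(l < j) m) :=
  \mxblock_(k < j, l < j) mxfun (fun z => Dlead hj a z k l) A.

(* The stacked increments U^{l+1} - U^l for l = 1, ..., j. *)
Definition increments {R : realType} {m : nat} (j : nat)
    (V : nat -> 'cV[R]_m) : 'cV[R]_(\sum_(l < j) m) :=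
  \mxcol_(l < j) (V l.+2 - V l.+1).

Definition preserves_energy_dissipation {R : realType} {m : nat} (s : nat)
    (a : nat -> nat -> R -> R) (L : 'M[R]_m) (G : R -> R) (kappa tau : R) :
    Prop :=
  forall (u : nat -> 'cV[R]_m) (U : nat -> nat -> 'cV[R]_m),
    is_scheme s a L (nonlin G) kappa tau u U ->
    forall (n j : nat) (hj : (j <= s)%N), (1 <= n)%N -> (1 <= j)%N ->
      let Q := inner (increments j (U n))
                 (Dblock hj a (- tau *: Lstab kappa L) *m
                  increments j (U n)) in
      energy L G (U n j.+1) - energy L G (U n 1%N) <= - tau^-1 * Q /\
      - tau^-1 * Q <= 0.

Definition TIF2_Ralston {R : realType} (i j : nat) (z : R) : R :=
  match i, j with
  | 2%N, 1%N => 2 / (3 - 2 * z)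
  | 3%N, 1%N =>
      expR (2 * z / 3) / ((4 - z) * expR (2 * z / 3) - 3 * z)
  | 3%N, 2%N => 3 / ((4 - z) * expR (2 * z / 3) - 3 * z)
  | _, _ => 0
  end.

Definition NIF2_Ralston {R : realType} (i j : nat) (z : R) : R :=
  match i, j with
  | 2%N, 1%N => (expR (2 * z / 3) - 1) / z
  | 3%N, 1%N => 4^-1 * expR z
  | 3%N, 2%N => (expR z - 1) / z - 4^-1 * expR z
  | _, _ => 0
  end.

(* Main.v *)
(** For A := - tau L_kappa, the definition of D says exactly that
      (D(A) delta)_k = tau g_kappa(U^k) + A U^(k+1) - A delta_k / 2,
    where delta_k = U^(k+1) - U^k.  As g is Lipschitz and kappa >= 2 l_g,
    - 1 / tau times the inner product of delta_k with the right-hand side bounds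
    E[U^(k+1)] - E[U^k], and these bounds add up to the dissipation law.
    Diagonalizing A, whose eigenvalues are negative, reduces the sign of the
    quadratic form to 4 d_11(z) d_22(z) >= d_21(z)^2 and d_11(z) > 0 for z < 0. *)

Require Import Defs.
From mathcomp Require Import all_boot all_order all_algebra.
From mathcomp Require Import all_classical all_reals all_analysis.
From mathcomp Require Import complex ring lra.

Import Order.TTheory GRing.Theory Num.Theory.
Import numFieldNormedType.Exports.

Local Open Scope ring_scope.

(** * Spectral theorem for real symmetric matrices *)

(** The complexification [B] is Hermitian, so it has a real eigenvalue. Being a root of the
    characteristic polynomial, this eigenvalue descends to [R] along the field morphism
    [real_complex]. *)
Lemma symmetric_eigenvalue (R : rcfType) n (A : 'M[R]_n.+1) :
  A^T = A -> exists a, eigenvalue A a.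
Proof.
move=> AT; pose B := map_mx (real_complex R) A.
have B_herm : B \is hermsymmx.
  apply: realsym_hermsym.
    apply/is_hermitianmxP; rewrite expr0 scale1r map_mx_id //.
    by rewrite /B -[in LHS]AT map_trmx.
  by apply/mxOverP => i j; rewrite mxE complex_real.
have /mxOverP/(_ 0 0) := hermitian_spectral_diag_real B_herm.
have /(orthomx_spectralP) := hermitian_normalmx B_herm.
set P := spectralmx B; set d := spectral_diag B => BE.
have P_unit : P \in unitmx := spectral_unit B.
have : eigenvalue B (d 0 0).
  apply/eigenvalueP; exists (row 0 P).
    rewrite -row_mul BE !mulmxA mulmxV // mul1mx row_mul row_diag_mx.
    by rewrite -scalemxAl -rowE.
  apply: contraTneq P_unit => P0; rewrite unitmxE (expand_det_row _ 0).
  rewrite big1 ?unitr0 // => j _; move/rowP: P0 => /(_ j).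
  by rewrite !mxE => ->; rewrite mul0r.
case: (d 0 0) => a b; rewrite eigenvalue_root_char -map_char_poly.
rewrite complex_real => + /eqP b0; rewrite b0.
rewrite (_ : Complex a 0 = real_complex R a) //.
by rewrite fmorph_root -eigenvalue_root_char; exists a.
Qed.

Lemma row_norm2E (R : rcfType) n (w : 'rV[R]_n) :
  (w *m w^T) 0 0 = \sum_i w 0 i ^+ 2.
Proof. by rewrite mxE; apply: eq_bigr => i _; rewrite mxE expr2. Qed.

Lemma row_norm2_gt0 (R : rcfType) n (w : 'rV[R]_n) :
  w != 0 -> 0 < (w *m w^T) 0 0.
Proof.
move=> w_neq0; have sqw i (_ : true) : 0 <= w 0 i ^+ 2 by exact: sqr_ge0.
rewrite row_norm2E lt_neqAle sumr_ge0 // andbT eq_sym psumr_eq0 //.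
apply: contraNN w_neq0 => /allP w0; apply/eqP/rowP => j; rewrite [RHS]mxE.
by have := w0 j (mem_index_enum _); rewrite sqrf_eq0 => /eqP.
Qed.

(* A Householder reflection. *)
Lemma orthogonal_first_row (R : rcfType) n (v : 'rV[R]_n.+1) :
  v *m v^T = 1%:M ->
  exists2 H : 'M[R]_n.+1, H *m H^T = 1%:M & row 0 H = v.
Proof.
move=> vv; pose e : 'rV[R]_n.+1 := delta_mx 0 0.
(* For [v = e] the reflection vector [w = v - e] vanishes, and the identity serves instead. *)
have [->|ve] := eqVneq v e.
  by exists 1%:M; rewrite ?trmx1 ?mulmx1 // row1.
have ee : e *m e^T = 1%:M.
  rewrite /e trmx_delta mul_delta_mx.
  by apply/matrixP => i j; rewrite !ord1 !mxE.
have [w wE] : exists w, w = v - e by exists (v - e).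
pose c := (w *m w^T) 0 0.
have wwE : w *m w^T = c%:M by rewrite [LHS]mx11_scalar.
pose b := (e *m v^T) 0 0.
have evE : e *m v^T = b%:M by rewrite [LHS]mx11_scalar.
have veE : v *m e^T = b%:M by rewrite -[v]trmxK -trmx_mul evE tr_scalar_mx.
have cE : c = 2 - 2 * b.
  rewrite /c wE linearB /= mulmxBl !mulmxBr vv ee veE evE !mxE /=.
  ring.
have c0 : c != 0.
  by rewrite gt_eqF // row_norm2_gt0 // wE subr_eq0.
pose H := 1%:M - (2 / c) *: (w^T *m w).
have HT : H^T = H.
  by rewrite /H linearB /= trmx1 linearZ /= trmx_mul trmxK.
exists H.
  have H2 : (w^T *m w) *m (w^T *m w) = c *: (w^T *m w).
    by rewrite mulmxA -[w^T *m w *m w^T]mulmxA wwE mul_mx_scalar -scalemxAl.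
  rewrite HT {1}/H mulmxBl mul1mx /H mulmxBr mulmx1 -scalemxAl -scalemxAr H2.
  rewrite !scalerA.
  move: (w^T *m w) => X; apply/matrixP => i j; rewrite !mxE.
  by field.
rewrite rowE -/e /H mulmxBr mulmx1 -scalemxAr mulmxA.
rewrite {1}wE linearB /= mulmxBr evE ee -raddfB mul_scalar_mx scalerA.
(* As [v] and [e] are unit vectors, [c = 2 - 2 * b], so the reflection sends [e] to [e + w = v]. *)
have -> : 2 / c * (b - 1) = - 1.
  apply: (mulfI c0); rewrite [in RHS]cE; field; exact: c0.
by rewrite scaleN1r opprK wE addrC subrK.
Qed.

(** Deflation: a unit eigenvector is completed to an orthogonal [H], and the induction hypothesis
    applies to the remaining block of [H A H^T]. Hence [mxfun] never takes its default value on a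
    symmetric matrix. *)
Lemma symmetric_orthodiag (R : realType) n (A : 'M[R]_n) :
  A^T = A -> exists Qd, orthodiag A Qd.
Proof.
elim: n A => [|n IHn] A AT.
  by exists (1%:M, 0); split; apply/matrixP => -[].
have [a /eigenvalueP[v0 v0A v0_neq0]] := symmetric_eigenvalue _ _ _ AT.
pose c := (v0 *m v0^T) 0 0.
have c_gt0 : 0 < c by exact: row_norm2_gt0.
pose v := (Num.sqrt c)^-1 *: v0.
have vA : v *m A = a *: v by rewrite -scalemxAl v0A scalerA mulrC -scalerA.
have vv : v *m v^T = 1%:M.
  rewrite linearZ /= -scalemxAl -scalemxAr scalerA [v0 *m _]mx11_scalar -/c.
  rewrite scale_scalar_mx -expr2 exprVn sqr_sqrtr ?ltW // mulVf //.
  by rewrite gt_eqF.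
have [H HH H0] := orthogonal_first_row _ _ _ vv.
have HH' := mulmx1C HH.
pose B : 'M[R]_(1 + n) := H *m A *m H^T.
have BT : B^T = B by rewrite /B !trmx_mul trmxK AT mulmxA.
have B0 : row 0 B = a *: delta_mx 0 0.
  rewrite /B !row_mul H0 vA -scalemxAl -H0 -row_mul HH.
  by rewrite row1.
pose B' : 'M[R]_n := drsubmx B.
(* The first row of [B] is [a] times a basis vector; by symmetry the first column is too. *)
have BE : B = block_mx a%:M 0 0 B'.
  rewrite -[LHS]submxK; congr block_mx.
  - apply/matrixP=> i j; rewrite !ord1 !mxE lshift0.
    by move/rowP: B0 => /(_ 0); rewrite !mxE !eqxx mulr1.
  - apply/matrixP=> i j; rewrite !ord1 !mxE lshift0.
    by move/rowP: B0 => /(_ (rshift 1 j)); rewrite !mxE /= => ->; rewrite mulr0.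
  - rewrite -BT; apply/matrixP=> i j; rewrite !ord1 !mxE lshift0.
    by move/rowP: B0 => /(_ (rshift 1 i)); rewrite !mxE /= => ->; rewrite mulr0.
have B'T : B'^T = B' by rewrite /B' trmx_drsub BT.
have [[P d] [/= PP B'E]] := IHn _ B'T.
pose K : 'M[R]_(1 + n) := block_mx 1%:M 0 0 P.
have KT : K^T = block_mx 1%:M 0 0 P^T.
  by rewrite /K tr_block_mx !trmx0 trmx1.
exists (K *m H, row_mx a%:M d); split => /=.
  rewrite trmx_mul mulmxA -[K *m H *m H^T]mulmxA HH mulmx1.
  suff: K *m K^T = 1%:M :> 'M[R]_(1 + n) by [].
  rewrite KT /K mulmx_block !mulmx0 !mul0mx !mulmx1 !addr0 add0r PP.
  by rewrite -scalar_mx_block.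
have -> : A = H^T *m B *m H.
  by rewrite /B !mulmxA HH' mul1mx -mulmxA HH' mulmx1.
rewrite trmx_mul !mulmxA; congr (_ *m _); rewrite -!mulmxA; congr (_ *m _).
suff: B = K^T *m (diag_mx (row_mx a%:M d) *m K) by rewrite /B -mulmxA.
rewrite BE KT /K diag_mx_row !mulmx_block !mulmx0 !mul0mx !addr0 !add0r.
rewrite B'E !mulmx1 !mul1mx -!mulmxA; congr block_mx.
  by apply/matrixP => i j; rewrite !ord1 !mxE.
all: by rewrite ?mulmx0 ?mul0mx.
Qed.

(** * Energy change over one stage *)

Lemma innerE (R : realType) m (u v : 'cV[R]_m) :
  inner u v = \sum_i u i 0 * v i 0.
Proof. by rewrite /inner mxE; apply: eq_bigr => i _; rewrite mxE mulrC. Qed.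

Lemma inner_orthogonal (R : realType) m (Q : 'M[R]_m) (u v : 'cV[R]_m) :
  Q *m Q^T = 1%:M -> inner (Q *m u) (Q *m v) = inner u v.
Proof.
move=> /mulmx1C QQ.
by rewrite /inner trmx_mul mulmxA -[_ *m Q^T *m Q]mulmxA QQ mulmx1.
Qed.

Lemma inner_mulmx_sym (R : realType) m (L : 'M[R]_m) (u v : 'cV[R]_m) :
  L^T = L -> inner u (L *m v) = inner v (L *m u).
Proof.
move=> LT; transitivity (((L *m v)^T *m u)^T 0 0); first by rewrite [RHS]mxE.
by rewrite trmx_mul trmxK /inner trmx_mul LT mulmxA.
Qed.

(* The mean value theorem gives lg where integrating G' would give lg / 2; this
   is what kappa >= 2 * lg absorbs. *)
Lemma nonlin_descent (R : realType) (G : R -> R) (lg x y : R) :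
  (forall x, derivable G x 1) -> 0 <= lg -> lg.-lipschitz (nonlin G) ->
  G y - G x <= - (nonlin G x * (y - x)) + lg * (y - x) ^+ 2.
Proof.
move=> G_diff lg_ge0 g_lip.
(* Stated by distance to [x], the bound serves the mean value point [c] for both orders of [x] and
   [y]. *)
have bound c : `|c - x| <= `|y - x| ->
    - nonlin G c * (y - x) <= - (nonlin G x * (y - x)) + lg * (y - x) ^+ 2.
  move=> cx; have /= gxc := g_lip (x, c) (conj I I).
  have -> : - nonlin G c * (y - x) =
      - (nonlin G x * (y - x)) + (nonlin G x - nonlin G c) * (y - x) by ring.
  rewrite lerD2l (le_trans (ler_norm _)) // normrM.
  rewrite -[(y - x) ^+ 2]real_normK ?num_real // expr2 mulrA ler_wpM2r //.
  by apply: (le_trans gxc); rewrite ler_wpM2l // distrC.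
have isd (z : R) : is_derive z 1 G (- nonlin G z).
  by apply: DeriveDef; rewrite ?opprK ?derive1E.
have cts (A : set R) : {within A, continuous G}%classic.
  apply: continuous_subspaceT => z; apply: differentiable_continuous.
  exact/derivable1_diffP.
have [xy|yx|->] := ltgtP x y; last by
  rewrite !subrr expr0n /= !mulr0 oppr0 addr0.
- have [c] := MVT xy (fun z _ => isd z) (cts _).
  rewrite in_itv /= => /andP[xc cy] ->; apply: bound.
  by rewrite !ger0_norm ?lerD2r ?subr_ge0 // ltW.
- have [c] := MVT yx (fun z _ => isd z) (cts _).
  rewrite in_itv /= => /andP[yc cx] E.
  rewrite -opprB E -mulrN opprB; apply: bound.
  by rewrite !ler0_norm ?lerN2 ?lerD2r ?subr_le0 // ltW.
Qed.

(** On the right, the terms in [kappa] reduce to [kappa / 2 * (w - v) ^+ 2] in each coordinate,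
    which dominates the remainder [lg * (w - v) ^+ 2] of [nonlin_descent]; the terms in [L] agree on
    both sides by symmetry. *)
Lemma energy_step (R : realType) m (L A : 'M[R]_m) (G : R -> R)
    (lg kappa tau : R) (v w : 'cV[R]_m) :
  A = - tau *: Lstab kappa L ->
  L^T = L -> (forall x, derivable G x 1) ->
  0 <= lg -> lg.-lipschitz (nonlin G) -> 2 * lg <= kappa -> 0 < tau ->
  energy L G w - energy L G v <=
    - tau^-1 * inner (w - v)
      (tau *: gstab kappa (nonlin G) v + A *m w - 2^-1 *: (A *m (w - v))).
Proof.
move=> -> LT G_diff lg_ge0 g_lip kappa_ge tau_gt0.
have tau0 : tau != 0 by rewrite gt_eqF.
pose l (u : 'cV[R]_m) : 'cV[R]_m := L *m u.
have Lvw : inner v (L *m w) = inner w (L *m v) by exact: inner_mulmx_sym.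
have -> : - tau^-1 * inner (w - v)
      (tau *: gstab kappa (nonlin G) v + - tau *: Lstab kappa L *m w -
       2^-1 *: (- tau *: Lstab kappa L *m (w - v))) =
   \sum_i (- (w i 0 - v i 0) * (kappa * v i 0 + nonlin G (v i 0)) +
     (w i 0 - v i 0) * (l w i 0 + kappa * w i 0) -
     2^-1 * (w i 0 - v i 0) * (l w i 0 - l v i 0 + kappa * (w i 0 - v i 0))).
  rewrite innerE mulr_sumr; apply: eq_bigr => i _.
  rewrite /gstab /Lstab -!scalemxAl !mulmxDl !mul_scalar_mx mulmxBr.
  rewrite -/(l w) -/(l v) !mxE; field.
  exact: tau0.
(* The inserted cross terms [w * l v - v * l w] sum to zero by symmetry of [L]; they make the two
   sides comparable coordinate by coordinate. *)
have -> : energy L G w - energy L G v =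
   \sum_i (2^-1 * (w i 0 * l w i 0 - v i 0 * l v i 0)
     + 2^-1 * (w i 0 * l v i 0 - v i 0 * l w i 0) + (G (w i 0) - G (v i 0))).
  have S : 2^-1 * (\sum_i w i 0 * l v i 0 - \sum_i v i 0 * l w i 0) = 0.
    by rewrite -!innerE Lvw subrr mulr0.
  have G1 u : inner (map_mx G u) (const_mx 1) = \sum_i G (u i 0).
    by rewrite innerE; apply: eq_bigr => i _; rewrite !mxE mulr1.
  rewrite /energy !G1 !innerE -/(l w) -/(l v) 2!big_split /= -!mulr_sumr !sumrB.
  by rewrite S; ring.
apply: ler_sum => i _.
have := nonlin_descent _ G lg (v i 0) (w i 0) G_diff lg_ge0 g_lip.
have k_ge0 : 0 <= kappa - 2 * lg by lra.
have := mulr_ge0 k_ge0 (sqr_ge0 (w i 0 - v i 0)).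
lra.
Qed.

(** * Structure of the differentiation matrix *)

Lemma Ahat_unit (R : realType) s (a : nat -> nat -> R -> R) (z : R) :
  (forall i, (1 <= i <= s)%N -> a i.+1 i z != 0) -> Ahat s a z \in unitmx.
Proof.
move=> a_neq0; have A_trig : is_trig_mx (Ahat s a z).
  by apply/is_trig_mxP => i j ij; rewrite mxE leqNgt ij.
rewrite unitmxE det_trig // unitfE; apply/prodf_neq0 => i _.
by rewrite mxE leqnn a_neq0 //= ltn_ord.
Qed.

(** Forward substitution in [Ahat B = Eones]: above the diagonal, once the earlier rows of [B] are
    known to vanish, row [k] leaves only the diagonal coefficient times [B k l], which must be
    zero. *)
Lemma Dmx_trig (R : realType) s (a : nat -> nat -> R -> R) (z : R) :
  (forall i, (1 <= i <= s)%N -> a i.+1 i z != 0) -> is_trig_mx (Dmx s a z).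
Proof.
move=> a_neq0; pose B := invmx (Ahat s a z) *m Eones s.
have AB : Ahat s a z *m B = Eones s by rewrite mulmxA mulmxV ?mul1mx ?Ahat_unit.
have B_trig n (k l : 'I_s) : (k < n)%N -> (k < l)%N -> B k l = 0.
  elim: n k => // n IHn k kn kl.
  have /matrixP/(_ k l) := AB; rewrite [RHS]mxE leqNgt kl mxE (bigD1 k) //=.
  rewrite big1 ?addr0 => [|i ik].
    rewrite mxE leqnn => /eqP.
    rewrite mulf_eq0 (negPf (a_neq0 k.+1 _)) ?ltn_ord //.
    by move=> /eqP.
  rewrite mxE; case: leqP => [ki|_]; last by rewrite mul0r.
  have {}ki : (i < k)%N by rewrite ltn_neqAle ki andbT.
  by rewrite IHn ?mulr0 ?(leq_trans ki kn) ?(ltn_trans ki kl).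
apply/is_trig_mxP => k l kl; have kl' : k != l by rewrite neq_ltn kl.
rewrite /Dmx -/B; move: B {AB} B_trig => B B_trig.
rewrite !mxE (B_trig k.+1) // leqNgt kl (negPf kl') /=.
by rewrite mulr0n !mulr0 subr0 addr0.
Qed.

(** [Eones] turns increments into differences from [y 1] by telescoping, and the scheme says that
    these are [Ahat] applied to the values of [f]. So [Ahat^-1 Eones] maps the increments to [f]. *)
Lemma Dmx_increments (R : realType) s (a : nat -> nat -> R -> R) (z : R)
    (y f : nat -> R) :
  (forall i, (1 <= i <= s)%N -> a i.+1 i z != 0) ->
  (forall i, (1 <= i <= s)%N ->
     y i.+1 = y 1%N + \sum_(1 <= j < i.+1) a i.+1 j z * f j) ->
  forall k : 'I_s, \sum_(l < s) Dmx s a z k l * (y l.+2 - y l.+1) =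
    f k.+1 + z * (y k.+2 - y 1%N) - z / 2 * (y k.+2 - y k.+1).
Proof.
move=> a_neq0 yE k.
pose d : 'cV[R]_s := \col_l (y l.+2 - y l.+1).
pose phi : 'cV[R]_s := \col_l f l.+1.
have Ed : Eones s *m d = \col_l (y l.+2 - y 1%N).
  apply/colP => i; rewrite !mxE.
  under eq_bigr do rewrite !mxE mulr_natl mulrb -ltnS.
  rewrite -big_mkcond /= (big_ord_narrow (ltn_ord i)) /=.
  by rewrite -(big_mkord xpredT (fun l => y l.+2 - y l.+1)) telescope_sumr.
have Aphi : Ahat s a z *m phi = Eones s *m d.
  rewrite Ed; apply/colP => i; rewrite !mxE yE ?ltn_ord // [RHS]addrC addKr.
  under eq_bigr do rewrite !mxE mulrC (fun_if ( *%R _)) mulr0 -ltnS.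
  rewrite -big_mkcond /= (big_ord_narrow (ltn_ord i)) /=.
  rewrite big_add1 /= big_mkord; apply: eq_bigr => l _; exact: mulrC.
transitivity ((Dmx s a z *m d) k 0).
  by rewrite [RHS]mxE; apply: eq_bigr => l _; rewrite [d _ _]mxE.
rewrite /Dmx mulmxBl mulmxDl -mulmxA -Aphi mulKmx ?Ahat_unit //.
by rewrite -!scalemxAl mul1mx Ed !mxE.
Qed.

(** By triangularity, the first [j] rows have no entries beyond column [j]. *)
Lemma Dlead_sum (R : realType) s j (hj : (j <= s)%N) (a : nat -> nat -> R -> R)
    (z : R) (x : nat -> R) :
  (forall i, (1 <= i <= s)%N -> a i.+1 i z != 0) ->
  forall k : 'I_j, \sum_(l < j) Dlead hj a z k l * x l =
    \sum_(l < s) Dmx s a z (widen_ord hj k) l * x l.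
Proof.
move=> a_neq0 k; rewrite [RHS](bigID (fun l : 'I_s => (l < j)%N)) /=.
rewrite [X in _ + X]big1 ?addr0 => [|l]; last first.
  rewrite -leqNgt => jl; have /is_trig_mxP -> := Dmx_trig _ _ _ _ a_neq0.
    by rewrite mul0r.
  exact: leq_trans (ltn_ord k) jl.
by rewrite (big_ord_narrow hj) /=; apply: eq_bigr => l _; rewrite mxE.
Qed.

(** The vector is padded with zeros to length [s]. *)
Lemma Dlead_psd (R : realType) s j (hj : (j <= s)%N) (a : nat -> nat -> R -> R)
    (z : R) (x : nat -> R) :
  (forall y : nat -> R,
     0 <= \sum_(k < s) \sum_(l < s) y k * (Dmx s a z k l * y l)) ->
  0 <= \sum_(k < j) \sum_(l < j) x k * (Dlead hj a z k l * x l).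
Proof.
move=> /(_ (fun l => if (l < j)%N then x l else 0)).
rewrite (bigID (fun l : 'I_s => (l < j)%N)) /=.
rewrite [X in _ + X]big1 ?addr0; last first.
  by move=> k /negPf ->; rewrite big1 // => l _; rewrite mul0r.
rewrite (big_ord_narrow hj) /=; congr (0 <= _); apply: eq_bigr => k _.
rewrite (bigID (fun l : 'I_s => (l < j)%N)) /=.
rewrite [X in _ + X]big1 ?addr0; last first.
  by move=> l /negPf ->; rewrite !mulr0.
rewrite (big_ord_narrow hj) /=; apply: eq_bigr => l _.
by rewrite !mxE !ltn_ord.
Qed.

(** * Block vectors and coordinates in an orthonormal eigenbasis *)

Lemma inner_increments (R : realType) m s j (hj : (j <= s)%N)
    (a : nat -> nat -> R -> R) (A : 'M[R]_m) (V : nat -> 'cV[R]_m) :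
  inner (increments j V) (Dblock hj a A *m increments j V) =
  \sum_(k < j) inner (V k.+2 - V k.+1)
    (\sum_(l < j) mxfun (fun z => Dlead hj a z k l) A *m (V l.+2 - V l.+1)).
Proof.
rewrite /inner /Dblock /increments mul_mxblock_mxrow tr_mxcol mul_mxrow_mxcol.
by rewrite summxE.
Qed.

Lemma mxfun_mul_coord (R : realType) m (f : R -> R) (A Q : 'M[R]_m) d
    (v : 'cV[R]_m) i :
  orthodiag A (Q, d) -> (Q *m (mxfun f A *m v)) i 0 = f (d 0 i) * (Q *m v) i 0.
Proof.
move=> AQ; rewrite (mxfunE f AQ) !mulmxA; case: AQ => /= -> _.
by rewrite mul1mx -mulmxA mul_diag_mx !mxE.
Qed.

Lemma mulmxB_coord (R : realType) m n p (Q : 'M[R]_(m, n)) (u v : 'M[R]_(n, p))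
    i k :
  (Q *m (u - v)) i k = (Q *m u) i k - (Q *m v) i k.
Proof. by rewrite mulmxBr [LHS]mxE [X in _ + X]mxE. Qed.

Lemma orthodiag_mul_coord (R : realType) m (A Q : 'M[R]_m) d
    (v : 'cV[R]_m) i :
  orthodiag A (Q, d) -> (Q *m (A *m v)) i 0 = d 0 i * (Q *m v) i 0.
Proof.
move=> -[/= QQ ->]; rewrite !mulmxA QQ.
by rewrite mul1mx -mulmxA mul_diag_mx !mxE.
Qed.

(** Test negativity on the unit eigenvector [Q^T e_i], where the form equals [d 0 i]. *)
Lemma orthodiag_lt0 (R : realType) m (A Q : 'M[R]_m) d i :
  (forall v : 'cV[R]_m, v != 0 -> inner v (A *m v) < 0) ->
  orthodiag A (Q, d) -> d 0 i < 0.
Proof.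
move=> A_neg AQ; have [/= QQ _] := AQ.
pose v := Q^T *m (delta_mx i 0 : 'cV[R]_m).
have Qv : Q *m v = delta_mx i 0 by rewrite mulmxA QQ mul1mx.
have v0 : v != 0.
  apply: contra_eq_neq Qv => ->; rewrite mulmx0.
  by apply/eqP => /colP/(_ i)/eqP; rewrite !mxE !eqxx eq_sym oner_eq0.
have := A_neg v v0; rewrite -(inner_orthogonal _ _ _ _ _ QQ) innerE (bigD1 i) //=.
rewrite big1 ?addr0 => [|k ki].
  by rewrite (orthodiag_mul_coord _ _ _ _ _ _ _ AQ) Qv mxE !eqxx mulr1 mul1r.
by rewrite Qv mxE (negPf ki) mul0r.
Qed.

(** * A criterion for any number of stages *)

(** Leaves only scalar facts at [z < 0] to be checked for each choice of coefficients. *)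
Lemma preserves_energy_dissipation_of_psd (R : realType) m s
    (a : nat -> nat -> R -> R) (L : 'M[R]_m) (G : R -> R) (lg kappa tau : R) :
  spd L -> (forall x, derivable G x 1) -> 0 <= lg ->
  lg.-lipschitz (nonlin G) -> 2 * lg <= kappa -> 0 < tau ->
  (forall z i, z < 0 -> (1 <= i <= s)%N -> a i.+1 i z != 0) ->
  (forall z (y : nat -> R), z < 0 ->
     0 <= \sum_(k < s) \sum_(l < s) y k * (Dmx s a z k l * y l)) ->
  preserves_energy_dissipation s a L G kappa tau.
Proof.
move=> [/is_hermitianmxP LT L_pos] G_diff lg_ge0 g_lip kappa_ge tau_gt0.
move=> a_neq0 D_psd u U U_scheme n j hj n1 j1 /=.
have {}LT : L^T = L.
  by rewrite [in RHS]LT expr0 scale1r map_mx_id.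
have kappa_ge0 : 0 <= kappa by lra.
set A := - tau *: Lstab kappa L.
have AT : A^T = A by rewrite /A /Lstab linearZ /= linearD /= LT tr_scalar_mx.
have A_neg (v : 'cV[R]_m) : v != 0 -> inner v (A *m v) < 0.
  move=> v0; have Lv := L_pos v v0.
  rewrite /inner -scalemxAl mulmxDl mul_scalar_mx linearZ /= -scalemxAl mxE.
  rewrite linearD /= mulmxDl mxE linearZ /= -scalemxAl [X in _ + X]mxE.
  rewrite mulNr oppr_lt0 pmulr_rgt0 // ltr_wpDr //.
  rewrite mulr_ge0 //; move: (innerE _ _ v v); rewrite /inner => ->.
  by apply: sumr_ge0 => i _; rewrite -expr2 sqr_ge0.
have [[Q d] AQ] := symmetric_orthodiag _ _ _ AT.
have QQ := AQ.1; rewrite /= in QQ.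
have d_lt0 i : d 0 i < 0 by exact: orthodiag_lt0 A_neg AQ.
have [_ UE _] := U_scheme n n1.
rewrite inner_increments -/A.
pose P (k : 'I_j) := \sum_(l < j)
  mxfun (fun z => Dlead hj a z k l) A *m (U n l.+2 - U n l.+1).
(* [P k] is the [k]-th block of [D_j(A)] applied to the increments. After applying [Q], each
   coordinate obeys the scalar recurrence of [Dmx_increments] at [z = d 0 i]. *)
have PE k : P k = tau *: gstab kappa (nonlin G) (U n k.+1) + A *m U n k.+2 -
    2^-1 *: (A *m (U n k.+2 - U n k.+1)).
  apply: (can_inj (mulKmx (proj1 (mulmx1_unit QQ)))); apply/colP => i.
  pose y l := (Q *m U n l) i 0.
  (* The term [- tau L_kappa U^1] of the scheme is [A U^1], hence the summand [d 0 i * y 1]. *)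
  pose f l := (Q *m (tau *: gstab kappa (nonlin G) (U n l))) i 0 + d 0 i * y 1%N.
  have yE l : (1 <= l <= s)%N ->
      y l.+1 = y 1%N + \sum_(1 <= j < l.+1) a l.+1 j (d 0 i) * f j.
    move=> ls; rewrite /y UE // mulmxDr mxE; congr (_ + _).
    rewrite mulmx_sumr summxE; apply: eq_bigr => h _.
    rewrite (mxfun_mul_coord _ _ _ _ _ _ _ _ AQ); congr (_ * _).
    rewrite mulmxB_coord /f /y.
    rewrite -(orthodiag_mul_coord _ _ _ _ _ _ _ AQ) /A -scalemxAl scaleNr.
    by rewrite mulmxN [X in _ = _ + X]mxE.
  transitivity (\sum_(l < j) Dlead hj a (d 0 i) k l * (y l.+2 - y l.+1)).
    rewrite /P mulmx_sumr summxE; apply: eq_bigr => l _.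
    rewrite (mxfun_mul_coord _ _ _ _ _ _ _ _ AQ).
    by rewrite mulmxB_coord.
  have ai i' : (1 <= i' <= s)%N -> a i'.+1 i' (d 0 i) != 0 by exact: a_neq0.
  rewrite (Dlead_sum _ _ _ _ _ _ (fun l => y l.+2 - y l.+1)) //.
  rewrite (Dmx_increments _ _ _ _ y f) //=.
  rewrite mulmxB_coord mulmxDr -[Q *m (2^-1 *: _)]scalemxAr.
  rewrite [X in _ = X - _]mxE.
  rewrite [X in _ = _ - X]mxE !(orthodiag_mul_coord _ _ _ _ _ _ _ AQ).
  rewrite mulmxB_coord -/(y _) -/(y _) /f.
  by ring.
have step k : energy L G (U n k.+2) - energy L G (U n k.+1) <=
     - tau^-1 * inner (U n k.+2 - U n k.+1)
      (tau *: gstab kappa (nonlin G) (U n k.+1) + A *m U n k.+2 -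
    2^-1 *: (A *m (U n k.+2 - U n k.+1))).
  exact: (energy_step _ _ _ _ _ lg).
split.
  rewrite mulr_sumr.
  have -> : energy L G (U n j.+1) - energy L G (U n 1) =
      \sum_(k < j) (energy L G (U n k.+2) - energy L G (U n k.+1)).
    by rewrite -(big_mkord xpredT (fun k => energy L G (U n k.+2) -
      energy L G (U n k.+1))) telescope_sumr.
  by apply: ler_sum => k _; rewrite -/(P k) PE.
rewrite mulNr oppr_le0 pmulr_rge0 ?invr_gt0 //.
under eq_bigr do rewrite -(inner_orthogonal _ _ _ _ _ QQ) innerE.
(* With the coordinate sum outermost, each summand is the scalar form of [D_j] at one eigenvalue. *)
rewrite exchange_big /=; apply: sumr_ge0 => i _.
pose y l := (Q *m U n l) i 0.
have := Dlead_psd _ _ _ hj a (d 0 i) (fun l => y l.+2 - y l.+1)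
  (fun x => D_psd _ x (d_lt0 i)).
congr (0 <= _); apply: eq_bigr => k _; rewrite -mulr_sumr mulmx_sumr summxE.
congr (_ * _); first by rewrite mulmxB_coord.
apply: eq_bigr => l _; rewrite (mxfun_mul_coord _ _ _ _ _ _ _ _ AQ).
by rewrite mulmxB_coord.
Qed.

(** * Positivity for two stages *)

Lemma quadratic_form_ge0 (R : realFieldType) (p q r x y : R) :
  0 < p -> r ^+ 2 <= 4 * p * q -> 0 <= p * x ^+ 2 + r * x * y + q * y ^+ 2.
Proof.
move=> p_gt0 rpq; rewrite -(@pmulr_rge0 _ (4 * p)) ?mulr_gt0 //.
have -> : 4 * p * (p * x ^+ 2 + r * x * y + q * y ^+ 2) =
  (2 * p * x + r * y) ^+ 2 + (4 * p * q - r ^+ 2) * y ^+ 2 by ring.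
by rewrite addr_ge0 ?sqr_ge0 // mulr_ge0 ?sqr_ge0 // subr_ge0.
Qed.

(** [p], [q], [r] are the entries [d_11], [d_22], [d_21] of [D(z)], while [d_12 = 0]. *)
Lemma Dmx2_psd (R : realType) (a : nat -> nat -> R -> R) (z : R)
    (x : nat -> R) :
  let p := (a 2%N 1%N z)^-1 + z / 2 in
  let q := (a 3%N 2%N z)^-1 + z / 2 in
  let r := (1 - a 3%N 1%N z / a 2%N 1%N z) / a 3%N 2%N z + z in
  a 2%N 1%N z != 0 -> a 3%N 2%N z != 0 -> 0 < p -> r ^+ 2 <= 4 * p * q ->
  0 <= \sum_(k < 2) \sum_(l < 2) x k * (Dmx 2 a z k l * x l).
Proof.
move=> p q r a21 a32 p_gt0 rpq.
(* For scalar stages y with increments x and terms f solving the scheme,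
   Dmx_increments evaluates D x without inverting Ahat. *)
pose y n := match n with 2%N => x 0%N | 3%N => x 0%N + x 1%N | _ => 0 end.
pose f n := match n with 1%N => x 0%N / a 2%N 1%N z |
  _ => (x 0%N + x 1%N - a 3%N 1%N z * (x 0%N / a 2%N 1%N z)) / a 3%N 2%N z end.
have a_neq0 i : (1 <= i <= 2)%N -> a i.+1 i z != 0 by case: i => [|[|[|]]].
have yE i : (1 <= i <= 2)%N ->
    y i.+1 = y 1%N + \sum_(1 <= j < i.+1) a i.+1 j z * f j.
  case: i => [|[|[|]]] // _.
    by rewrite big_nat1 /f /y; field.
  by rewrite big_nat_recr //= big_nat1 /f /y; field; rewrite a21 a32.
have DE := Dmx_increments _ _ _ _ y f a_neq0 yE.
under eq_bigr do rewrite -mulr_sumr.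
have := quadratic_form_ge0 _ _ _ _ (x 0%N) (x 1%N) p_gt0 rpq.
congr (0 <= _); rewrite big_ord_recl big_ord1.
have -> : \sum_(l < 2) Dmx 2 a z ord0 l * x l = p * x 0%N.
  transitivity (\sum_(l < 2) Dmx 2 a z ord0 l * (y l.+2 - y l.+1)).
    by rewrite !big_ord_recl !big_ord0 /= subr0 (addrC (x 0%N)) addrK.
  by rewrite DE /= /p subr0; field.
have -> : \sum_(l < 2) Dmx 2 a z (lift ord0 ord0) l * x l =
    r * x 0%N + q * x 1%N.
  transitivity (\sum_(l < 2) Dmx 2 a z (lift ord0 ord0) l * (y l.+2 - y l.+1)).
    by rewrite !big_ord_recl !big_ord0 /= subr0 (addrC (x 0%N)) addrK.
  by rewrite DE /= /r /q subr0; field; rewrite a21 a32.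
by rewrite /=; ring.
Qed.

(** * The TIF2-Ralston coefficients *)

Lemma TIF2_Ralston_den_gt0 (R : realType) (z : R) :
  z < 0 -> 0 < (4 - z) * expR (2 * z / 3) - 3 * z.
Proof.
move=> z_lt0; have := mulr_gt0 (_ : 0 < 4 - z) (expR_gt0 (2 * z / 3)).
by move=> /(_ ltac:(lra)); lra.
Qed.

Lemma TIF2_Ralston_diag (R : realType) (z : R) i :
  z < 0 -> (1 <= i <= 2)%N -> TIF2_Ralston i.+1 i z != 0.
Proof.
move=> z_lt0; have den := TIF2_Ralston_den_gt0 _ _ z_lt0.
case: i => [|[|[|]]] // _; rewrite /= mulf_neq0 ?invr_eq0 ?pnatr_eq0 // ?gt_eqF //.
lra.
Qed.

(** With [y = exp(2z/3)], [d_21] collapses to [5/6 y], and [4 d_11 d_22 = 2/3 (3 - z)(4 - z) y - z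
    (3 - z)] is at least [8 y], which suffices since [0 < y < 1]. *)
Lemma TIF2_Ralston_psd (R : realType) (z : R) (x : nat -> R) : z < 0 ->
  0 <= \sum_(k < 2) \sum_(l < 2) x k * (Dmx 2 TIF2_Ralston z k l * x l).
Proof.
move=> z_lt0; have den := TIF2_Ralston_den_gt0 _ _ z_lt0.
have y_gt0 := expR_gt0 (2 * z / 3).
have y_lt1 : expR (2 * z / 3) < 1 by rewrite expR_lt1; lra.
have z32 : 3 - 2 * z != 0 by rewrite gt_eqF //; lra.
apply: Dmx2_psd; rewrite ?TIF2_Ralston_diag //=.
  by rewrite invf_div; lra.
move: (expR _) den y_gt0 y_lt1 => y den y_gt0 y_lt1.
have -> : (1 - y / ((4 - z) * y - 3 * z) / (2 / (3 - 2 * z))) /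
    (3 / ((4 - z) * y - 3 * z)) + z = 5 / 6 * y.
  by field; rewrite z32 gt_eqF.
rewrite !invf_div.
(* Signs of the monomials in the expanded product, which make the claim linear for [lra]. *)
have : 0 <= (- z) * y by rewrite mulr_ge0; lra.
have : 0 <= (- z) * (- z) by rewrite mulr_ge0; lra.
have : 0 <= (- z) * (- z) * y by rewrite !mulr_ge0; lra.
have : y ^+ 2 <= y by rewrite expr2 ger_pMl // ltW.
lra.
Qed.

(** * The NIF2-Ralston coefficients *)

(** Multiply [1 - z <= exp(-z)] by [exp z]. The right-hand side is [- z] times the coefficient
    [a_32]. *)
Lemma NIF2_Ralston_den_gt0 (R : realType) (z : R) : z < 0 ->
  3 / 4 * - z * expR z <= 1 - expR z + z / 4 * expR z.
Proof.
move=> z_lt0; have := expR_ge1Dx (- z); rewrite expRN => h.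
have := ler_wpM2r (ltW (expR_gt0 z)) h; rewrite mulVf ?gt_eqF ?expR_gt0 //.
lra.
Qed.

Lemma NIF2_Ralston_diag (R : realType) (z : R) i :
  z < 0 -> (1 <= i <= 2)%N -> NIF2_Ralston i.+1 i z != 0.
Proof.
move=> z_lt0; have den := NIF2_Ralston_den_gt0 _ _ z_lt0.
have z0 : z != 0 by rewrite lt_eqF.
have zw : 0 < - z * expR z by rewrite mulr_gt0 ?expR_gt0 ?oppr_gt0.
case: i => [|[|[|]]] // _ /=.
  by rewrite mulf_neq0 ?invr_eq0 // lt_eqF // subr_lt0 expR_lt1; lra.
have -> : (expR z - 1) / z - 4^-1 * expR z =
  (1 - expR z + z / 4 * expR z) / - z by field.
by rewrite mulf_neq0 ?invr_eq0 ?oppr_eq0 // gt_eqF //; lra.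
Qed.

(** Put [w = exp z], [y = exp(2z/3)], [P = - z a_32]. Cancelling [(z / P)^2] reduces the
    discriminant condition to [(w B)^2 (1 - y) <= (1 + y) (2 - P) P], and [P] separates the two
    sides. *)
Lemma NIF2_Ralston_psd (R : realType) (z : R) (x : nat -> R) : z < 0 ->
  0 <= \sum_(k < 2) \sum_(l < 2) x k * (Dmx 2 NIF2_Ralston z k l * x l).
Proof.
move=> z_lt0; have den := NIF2_Ralston_den_gt0 _ _ z_lt0.
have z0 : z != 0 by rewrite lt_eqF.
have w_gt0 := expR_gt0 z.
have w_lt1 : expR z < 1 by rewrite expR_lt1.
have y_gt0 := expR_gt0 (2 * z / 3).
have y_lt1 : expR (2 * z / 3) < 1 by rewrite expR_lt1; lra.
have y_ge : 1 + 2 * z / 3 <= expR (2 * z / 3) by exact: expR_ge1Dx.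
have y_le : (1 - 2 * z / 3) * expR (2 * z / 3) <= 1.
  have := expR_ge1Dx (- (2 * z / 3)); rewrite expRN => h.
  by have := ler_wpM2r (ltW y_gt0) h; rewrite mulVf ?gt_eqF.
apply: Dmx2_psd; rewrite ?NIF2_Ralston_diag //=.
all: move: (expR (2 * z / 3)) y_gt0 y_lt1 y_ge y_le => y y_gt0 y_lt1 y_ge y_le.
  rewrite invf_div.
  have -> : z / (y - 1) + z / 2 = (- z) * (1 + y) / (2 * (1 - y)).
    by field; apply/andP; split; lra.
  by rewrite divr_gt0 // mulr_gt0; lra.
move: (expR z) den w_gt0 w_lt1 => w den w_gt0 w_lt1.
have zw : 0 < - z * w by rewrite mulr_gt0 // oppr_gt0.
pose P := 1 - w + z / 4 * w.
have P_gt0 : 0 < P by rewrite /P; lra.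
have P_lt1 : P < 1 by rewrite /P; lra.
have P0 : P != 0 by rewrite gt_eqF.
have y1 : 1 - y != 0 by rewrite gt_eqF ?subr_gt0.
have y1' : y - 1 != 0 by rewrite lt_eqF ?subr_lt0.
have -> : (w - 1) / z - 4^-1 * w = P / - z by rewrite /P; field.
pose B := 1 + z * y / (4 * (1 - y)).
have -> : (1 - 4^-1 * w / ((y - 1) / z)) / (P / - z) + z =
    - z * w * B / P.
  have -> : - z * w * B = z * (P - 1 + w * z / (4 * (y - 1))).
    by rewrite /B /P; field; rewrite y1 y1'.
  by field; rewrite z0 y1' P0.
have -> : 4 * (((y - 1) / z)^-1 + z / 2) * ((P / - z)^-1 + z / 2) =
    (z / P) ^+ 2 * ((1 + y) * (2 - P) * P / (1 - y)).
  by field; rewrite z0 y1 y1' P0.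
have -> : (- z * w * B / P) ^+ 2 = (z / P) ^+ 2 * (w * B) ^+ 2 by field.
rewrite ler_wpM2l ?sqr_ge0 // ler_pdivlMr ?subr_gt0 //.
(* The bound [y_le] gives [1 - y >= - (2/3) z y], so the numerator is nonnegative. *)
have B_ge0 : 0 <= B.
  have -> : B = (4 * (1 - y) + z * y) / (4 * (1 - y)) by rewrite /B; field.
  by rewrite divr_ge0; lra.
have B_le1 : B <= 1.
  rewrite /B gerDl pmulr_lle0 ?invr_gt0 ?mulr_gt0 ?subr_gt0 //.
  by rewrite pmulr_lle0 // ltW.
have wB_le : (w * B) ^+ 2 <= w.
  have wB : w * B <= w by rewrite ler_piMr // ltW.
  have wB0 : 0 <= w * B by rewrite mulr_ge0 // ltW.
  by rewrite (le_trans _ wB) // expr2 ler_piMr // (le_trans wB) // ltW.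
apply: (@le_trans _ _ P).
  (* Here [1 - y <= - 2z/3] by [y_ge], and [P >= - (3/4) z w] by [den]; the claim uses
     [2/3 <= 3/4]. *)
  apply: (@le_trans _ _ (w * (- (2 * z / 3)))); last by rewrite /P; lra.
  apply: (@le_trans _ _ (w * (1 - y))).
    by rewrite ler_wpM2r // subr_ge0 ltW.
  by rewrite ler_wpM2l //; lra.
rewrite -[leLHS]mul1r ler_wpM2r 1?ltW //.
(* [(1 + y) (2 - P) = 1 + (1 - P) + y + y (1 - P)], a sum of [1] and nonnegative terms. *)
have : 0 <= y * (1 - P) by rewrite mulr_ge0; lra.
lra.
Qed.

Theorem theorem3p2 (R : realType) (M : nat) (L : 'M[R]_M) (G : R -> R)
    (lg kappa tau : R)
    (L_spd : spd L)
    (G_ge0 : forall x : R, 0 <= G x)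
    (G_diff : forall x : R, derivable G x 1)
    (lg_gt0 : 0 < lg)
    (g_lip : lg.-lipschitz (nonlin G))
    (kappa_ge : 2 * lg <= kappa)
    (tau_gt0 : 0 < tau) :
  preserves_energy_dissipation 2 TIF2_Ralston L G kappa tau /\
  preserves_energy_dissipation 2 NIF2_Ralston L G kappa tau.
Proof.
split; apply: (preserves_energy_dissipation_of_psd _ _ _ _ _ _ lg) => //.
- exact: ltW.
- exact: TIF2_Ralston_diag.
- exact: TIF2_Ralston_psd.
- exact: ltW.
- exact: NIF2_Ralston_diag.
- exact: NIF2_Ralston_psd.
Qed.
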